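(* For all $n$ large enough the following holds. Let $(X,Y,z_0)\in\Omega_n$ and let $\sigma=\rho(X,Y,z_0)$. Then $\sigma\in Sq(n)$, with $$\mathrm{LRmin}(\sigma)=\Lambda_1,\quad \mathrm{LRmax}(\sigma)=\Lambda_2\cup\{(1,z_1)\},\quad \mathrm{RLmin}(\sigma)=\Lambda_3\cup\{(z_0,1)\},\quad \mathrm{RLmax}(\sigma)=\Lambda_4\cup\{(z_2,n),(n,z_3)\}.$$ Moreover, $\rho$ is injective on $\Omega_n$ and $\phi\circ\rho$ is the identity on $\Omega_n$.
   Context: Records and square permutations. For a permutation $\sigma$ of $[n]$, $(i,\sigma(i))$ is in $\mathrm{LRmax}$ (resp. $\mathrm{LRmin}$) if $\sigma(i)>\sigma(j)$ (resp. $<$) for all $j<i$, and in $\mathrm{RLmax}$ (resp. $\mathrm{RLmin}$) if $\sigma(i)>\sigma(j)$ (resp. $<$) for all $j>i$. $\sigma$ is square if every point is in at least one of these sets; $Sq(n)$ is the set of square permutations of size $n$. The map $\phi:Sq(n)\to\{U,D\}^n\times\{L,R\}^n\times[n]$. $\phi(\sigma)=(X,Y,z_0)$ with $z_0=\sigma^{-1}(1)$, $X_1=X_n=D$, $Y_1=Y_n=L$, and for $2\le i\le n-1$: $X_i=D$ if $(i,\sigma(i))\in\mathrm{LRmin}\cup\mathrm{RLmin}$ and $X_i=U$ if $(i,\sigma(i))\in\mathrm{LRmax}\cup\mathrm{RLmax}$; $Y_i=L$ if $(\sigma^{-1}(i),i)\in\mathrm{LRmin}\cup\mathrm{LRmax}$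 and $Y_i=R$ if $(\sigma^{-1}(i),i)\in\mathrm{RLmin}\cup\mathrm{RLmax}$; if $(i,\sigma(i))\in\mathrm{LRmax}\cap\mathrm{RLmin}$ or $(i,\sigma(i))\in\mathrm{LRmin}\cap\mathrm{RLmax}$, then $X_i=D$ and $Y_{\sigma(i)}=L$. Counting functions. For $X\in\{U,D\}^n$ and a label $A\in\{U,D\}$, $ct_A(i)$ is the number of $A$'s among $X_1,\dots,X_i$ ($ct_A(0)=0$), and $pos_A(i)$ is the index of the $i$-th $A$ in $X$, with $pos_A(0)=0$ and $pos_A(i)=n$ if $i>ct_A(n)$. The functions $ct_L,ct_R,pos_L,pos_R$ are defined in the same way from $Y\in\{L,R\}^n$. Petrov conditions. A label $A$ satisfies the Petrov conditions if: (1) $|ct_A(i)-ct_A(j)-\frac12(i-j)|<n^{0.4}$ for all $0\le i,j\le n$ with $|i-j|<n^{0.6}$; (2) $|ct_A(i)-ct_A(j)-\frac12(i-j)|<\frac12|i-j|^{0.6}$ for all $0\le i,j\le n$ with $|i-j|>n^{0.3}$; (3) $|pos_A(i)-pos_A(j)-2(i-j)|<n^{0.4}$ for all $0\le i,j\le ct_A(n)$ with $|i-j|<n^{0.6}$; (4) $|pos_A(i)-pos_A(j)-2(i-j)|<2|i-j|^{0.6}$ for all $0\le i,j\le ct_A(n)$ with $|i-j|>n^{0.3}$. The sequence $X$ (resp. $Y$) satisfies the Petrov conditions if both its labels do. $\Omega_n$ is the set of triples $(X,Y,z_0)\in\{U,D\}^n\times\{L,R\}^n\times[n]$ with $X_1=X_n=X_{z_0}=D$,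 $Y_1=Y_n=L$, such that $X$ and $Y$ satisfy the Petrov conditions and $n^{0.9}\le z_0\le n-n^{0.9}$. The map $\rho$. For $(X,Y,z_0)\in\Omega_n$ let $z_1=pos_L(ct_D(z_0))$, $z_2=pos_U(ct_L(n)-ct_D(z_0))$, $z_3=pos_R(ct_D(n)-ct_D(z_0))$ and $\Lambda_1=\{(pos_D(i),pos_L(ct_D(z_0)+1-i)):1\le i\le ct_D(z_0)\}$, $\Lambda_2=\{(pos_U(i),pos_L(ct_D(z_0)+i)):1\le i\le ct_U(z_2)\}$, $\Lambda_3=\{(pos_D(i),pos_R(i-ct_D(z_0))):ct_D(z_0)+1\le i\le ct_D(n)\}$, $\Lambda_4=\{(pos_U(i),pos_R(n-ct_D(z_0)+1-i)):ct_U(z_2)+1\le i\le ct_U(n)\}$. For $n$ large enough, $\Lambda_1\cup\Lambda_2\cup\Lambda_3\cup\Lambda_4$ is the diagram $\{(i,\sigma(i)):i\in[n]\}$ of a permutation $\sigma$ of $[n]$, and $\rho(X,Y,z_0)$ denotes this permutation. *)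

(* Defs.v *)
From HB Require Import structures.
From mathcomp Require Import all_boot all_order all_algebra all_fingroup.
From mathcomp Require Import boolp classical_sets functions reals exp.

Set Implicit Arguments.
Unset Strict Implicit.
Unset Printing Implicit Defensive.

Import Order.TTheory GRing.Theory Num.Theory.

Local Open Scope classical_set_scope.

Inductive ud := Up | Down.
Inductive lr := Lft | Rgt.

Definition bool_of_ud (a : ud) := if a is Up then true else false.
Definition ud_of_bool (b : bool) := if b then Up else Down.
Lemma bool_of_udK : cancel bool_of_ud ud_of_bool. Proof. by case. Qed.
HB.instance Definition _ := Equality.copy ud (can_type bool_of_udK).

Definition bool_of_lr (a : lr) := if a is Lft then true else false.
Definition lr_of_bool (b : bool) := if b then Lft else Rgt.
Lemma bool_of_lrK : cancel bool_of_lr lr_of_bool. Proof. by case. Qed.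
HB.instance Definition _ := Equality.copy lr (can_type bool_of_lrK).

(* Permutations of {1, ..., n} are elements of 'S_n, whose indices start at 0;
   points of the plane are pairs of naturals and are always 1-based. *)
Section Records.
Variables (n : nat) (s : 'S_n).

Definition pt (i : 'I_n) : nat * nat := (i.+1, (s i).+1).

Definition diagram : set (nat * nat) := range pt.

Definition LRmax : set (nat * nat) :=
  [set pt i | i in [set i : 'I_n | forall j : 'I_n, j < i -> s j < s i]].
Definition LRmin : set (nat * nat) :=
  [set pt i | i in [set i : 'I_n | forall j : 'I_n, j < i -> s i < s j]].
Definition RLmax : set (nat * nat) :=
  [set pt i | i in [set i : 'I_n | forall j : 'I_n, i < j -> s j < s i]].
Definition RLmin : set (nat * nat) :=
  [set pt i | i in [set i : 'I_n | forall j : 'I_n, i < j -> s i < s j]].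

End Records.

Definition Sq (n : nat) : set 'S_n :=
  [set s | diagram s `<=` LRmax s `|` LRmin s `|` RLmax s `|` RLmin s].
Arguments Sq : clear implicits.

(* The last component is a 1-based element of {1, ..., n}. *)
Definition triple (n : nat) : Type := n.-tuple ud * n.-tuple lr * nat.

(* Only meaningful on Sq n.  There, a point of abscissa other than 1 and n that
   lies in both LRmin `|` RLmin and LRmax `|` RLmax is in LRmin `&` RLmax or in
   LRmax `&` RLmin, where the label is Down by convention; similarly for
   ordinates and Lft.  Testing Down and Lft first implements this convention. *)
Definition phi (n : nat) (s : 'S_n) : triple n :=
  ([tuple if [|| i == 0 :> nat, i.+1 == n
               | pt s i \in LRmin s `|` RLmin s] then Down else Up | i < n],
   [tuple if [|| v == 0 :> nat, v.+1 == n
               | pt s (s^-1%g v) \in LRmin s `|` LRmax s]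
          then Lft else Rgt | v < n],
   if [pick i : 'I_n | s i == 0 :> nat] is Some i then i.+1 else 0).

Section Counting.
Variables (T : eqType) (A : T) (n : nat) (w : n.-tuple T).

Definition ct (i : nat) : nat := count_mem A (take i w).

(* The entry of index i >= 1 of this list is the 1-based index of the i-th A;
   the leading 0 and the default value n give pos 0 = 0 and
   pos i = n for i > ct n. *)
Definition pos (i : nat) : nat :=
  nth n (0 :: [seq j <- iota 1 n | onth w j.-1 == Some A]) i.

End Counting.

Section Petrov.
Local Open Scope ring_scope.
Variables (R : realType) (T : eqType) (n : nat).

Definition petrov_label (A : T) (w : n.-tuple T) : Prop :=
  [/\ forall i j : nat, (i <= n)%N -> (j <= n)%N ->
        `|i%:R - j%:R : R| < n%:R `^ (6 / 10) ->
        `|(ct A w i)%:R - (ct A w j)%:R - 1 / 2 * (i%:R - j%:R) : R|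
          < n%:R `^ (4 / 10),
      forall i j : nat, (i <= n)%N -> (j <= n)%N ->
        `|i%:R - j%:R : R| > n%:R `^ (3 / 10) ->
        `|(ct A w i)%:R - (ct A w j)%:R - 1 / 2 * (i%:R - j%:R) : R|
          < 1 / 2 * `|i%:R - j%:R : R| `^ (6 / 10),
      forall i j : nat, (i <= ct A w n)%N -> (j <= ct A w n)%N ->
        `|i%:R - j%:R : R| < n%:R `^ (6 / 10) ->
        `|(pos A w i)%:R - (pos A w j)%:R - 2 * (i%:R - j%:R) : R|
          < n%:R `^ (4 / 10)
    & forall i j : nat, (i <= ct A w n)%N -> (j <= ct A w n)%N ->
        `|i%:R - j%:R : R| > n%:R `^ (3 / 10) ->
        `|(pos A w i)%:R - (pos A w j)%:R - 2 * (i%:R - j%:R) : R|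
          < 2 * `|i%:R - j%:R : R| `^ (6 / 10)].

Definition petrov (w : n.-tuple T) : Prop := forall A : T, petrov_label A w.

End Petrov.

Definition Omega (R : realType) (n : nat) : set (triple n) :=
  [set w : triple n | let: (X, Y, z0) := w in
    [/\ 1 <= z0 <= n,
        [/\ onth X 0 = Some Down, onth X n.-1 = Some Down
          & onth X z0.-1 = Some Down],
        onth Y 0 = Some Lft /\ onth Y n.-1 = Some Lft,
        petrov R X /\ petrov R Y
      & (n%:R `^ (9 / 10) <= (z0%:R : R) <= n%:R - n%:R `^ (9 / 10))%R]].
Arguments Omega : clear implicits.

Section Rho.
Variables (n : nat) (X : n.-tuple ud) (Y : n.-tuple lr) (z0 : nat).

Definition z1 : nat := pos Lft Y (ct Down X z0).
Definition z2 : nat := pos Up X (ct Lft Y n - ct Down X z0).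
Definition z3 : nat := pos Rgt Y (ct Down X n - ct Down X z0).

Definition Lambda1 : set (nat * nat) :=
  [set (pos Down X i, pos Lft Y (ct Down X z0 + 1 - i))
     | i in [set i | 1 <= i <= ct Down X z0]].
Definition Lambda2 : set (nat * nat) :=
  [set (pos Up X i, pos Lft Y (ct Down X z0 + i))
     | i in [set i | 1 <= i <= ct Up X z2]].
Definition Lambda3 : set (nat * nat) :=
  [set (pos Down X i, pos Rgt Y (i - ct Down X z0))
     | i in [set i | ct Down X z0 + 1 <= i <= ct Down X n]].
Definition Lambda4 : set (nat * nat) :=
  [set (pos Up X i, pos Rgt Y (n - ct Down X z0 + 1 - i))
     | i in [set i | ct Up X z2 + 1 <= i <= ct Up X n]].

Definition Lambda : set (nat * nat) :=
  Lambda1 `|` Lambda2 `|` Lambda3 `|` Lambda4.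

End Rho.

(* The identity is a junk value for triples whose Lambda is not the diagram of
   a permutation. *)
Definition rho (n : nat) (w : triple n) : 'S_n :=
  let: (X, Y, z0) := w in xget 1%g [set s : 'S_n | diagram s = Lambda X Y z0].

(* Main.v *)
(** Up to an error [E] of order [n ^ 0.6], the Petrov conditions place the four
    pieces on the sides of a tilted rectangle: [Lambda1] on [x + y = z0],
    [Lambda2] on [y = x + z0], [Lambda3] on [y = x - z0] and [Lambda4] on
    [x + y = 2 n - z0].  Since [z0] and [n - z0] are at least [n ^ 0.9],
    [Lambda1] lies below the antidiagonal [x + y = n] and [Lambda4] above it,
    while the diagonal [y = x] separates [Lambda2] from [Lambda3].  As each
    piece is monotone, this separation makes the points of each side records of
    the expected kind; conversely a point on one side is kept from being a
    record of another kind by a corner of the rectangle or by the point of the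
    opposite side with the nearest abscissa.  The labels [X] and [Y] can then be
    read off the records, so [phi] inverts [rho], which is therefore injective. *)

Require Import Defs.
From mathcomp Require Import all_boot all_order all_algebra all_fingroup.
From mathcomp Require Import boolp classical_sets functions reals exp.
From mathcomp Require Import zify lra.

Local Open Scope classical_set_scope.

Import Order.TTheory GRing.Theory Num.Theory.

(** * Counting and position functions as mutually inverse maps *)

Section Counting.
Context {T : eqType} {n : nat}.
Implicit Types (A B : T) (w : n.-tuple T).

(** Puts [ct] over the list of 1-based indices that [pos] filters, so that ranks in the filtered
    list become counts. *)
Lemma ctE A w i : i <= n ->
  ct A w i = count (fun j => onth w j.-1 == Some A) (iota 1 i).
Proof.
elim: i => [|i IH] lein; first by rewrite /ct take0.
rewrite -(addn1 i) iotaD count_cat -IH; last exact: ltnW.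
have x0 := tnth w (Ordinal lein).
have szw : i < size w by rewrite size_tuple.
rewrite /ct addn1 (take_nth x0) // -cats1 count_cat /= !addn0.
by rewrite -(odflt_onth x0); case E: (onth w i) => [a|]; move: (szw); rewrite -onthTE E.
Qed.

Lemma ct0 A w : ct A w 0 = 0.
Proof. by rewrite /ct take0. Qed.

Lemma pos0 A w : pos A w 0 = 0.
Proof. by []. Qed.

Lemma ctS A w x : 1 <= x <= n ->
  ct A w x = ct A w x.-1 + (onth w x.-1 == Some A).
Proof.
case: x => [//|x] /= ltxn.
by rewrite !ctE ?(ltnW ltxn)// -(addn1 x) iotaD count_cat /= addn0.
Qed.

Lemma leq_ct A w x y : x <= y -> y <= n -> ct A w x <= ct A w y.
Proof.
move=> xy yn; rewrite !ctE ?(leq_trans xy yn)//.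
by rewrite -(subnKC xy) iotaD count_cat leq_addr.
Qed.

Lemma ct_pred A w x : 1 <= x <= n -> onth w x.-1 = Some A ->
  ct A w x = (ct A w x.-1).+1.
Proof. by move=> xn wx; rewrite ctS// wx eqxx addn1. Qed.

(** Exactly [ct A w x.-1] entries of the filtered list precede [x]; the leading 0 in [pos] makes
    ranks start at 1. *)
Lemma pos_ct A w x : 1 <= x <= n -> onth w x.-1 = Some A ->
  pos A w (ct A w x) = x.
Proof.
move=> /[dup] xn /andP[x0 xln] wx.
rewrite ct_pred// /pos /= ctE; last by lia.
have -> : iota 1 n = iota 1 x.-1 ++ x :: iota x.+1 (n - x).
  have -> : x :: iota x.+1 (n - x) = iota (1 + x.-1) (n - x).+1.
    by rewrite add1n prednK.
  by rewrite -iotaD; congr iota; lia.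
by rewrite filter_cat nth_cat size_filter ltnn subnn /= wx eqxx.
Qed.

Section Position.
Variables (A : T) (w : n.-tuple T) (i : nat).
Hypothesis i_range : 1 <= i <= ct A w n.

Let size_pos : i.-1 < size [seq j <- iota 1 n | onth w j.-1 == Some A].
Proof. by rewrite size_filter -ctE//; lia. Qed.

Let mem_pos :
  pos A w i \in [seq j <- iota 1 n | onth w j.-1 == Some A].
Proof.
rewrite /pos; case: i i_range size_pos => [//|k] _ /= kl.
exact: mem_nth.
Qed.

Lemma pos_range : 1 <= pos A w i <= n.
Proof. by have := mem_pos; rewrite mem_filter mem_iota add1n ltnS => /andP[]. Qed.

Lemma onth_pos : onth w (pos A w i).-1 = Some A.
Proof. by have := mem_pos; rewrite mem_filter => /andP[/eqP]. Qed.

(** By [pos_ct], the ranks [ct A w (pos A w i)] and [i] carry the same entry of a duplicate-free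
    list, so they coincide. *)
Lemma ct_pos : ct A w (pos A w i) = i.
Proof.
have xn := pos_range; have wx := onth_pos.
have := pos_ct _ _ _ xn wx; rewrite ct_pred//.
have : ct A w (pos A w i) <= ct A w n by apply: leq_ct; lia.
rewrite ct_pred// {4}/pos /pos /=; case: i i_range size_pos => [//|k] _ /= kl.
set m := ct _ _ _ => mn /eqP; rewrite nth_uniq //; last 2 first.
- by rewrite size_filter -ctE.
- by rewrite filter_uniq ?iota_uniq.
by move=> /eqP ->.
Qed.

End Position.

Lemma leq_pos A w i j : i <= ct A w n -> j <= ct A w n ->
  (pos A w i <= pos A w j) = (i <= j).
Proof.
case: i => [|i]; first by rewrite pos0.
case: j => [|j] hi hj.
  by rewrite pos0 !leqn0; have := pos_range _ _ i.+1 hi; lia.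
have ci := ct_pos _ _ i.+1 hi; have cj := ct_pos _ _ j.+1 hj.
have ri := pos_range _ _ i.+1 hi; have rj := pos_range _ _ j.+1 hj.
have := @leq_ct A w (pos A w i.+1) (pos A w j.+1).
have := @leq_ct A w (pos A w j.+1) (pos A w i.+1).
rewrite ci cj; case: (leqP (pos A w i.+1) (pos A w j.+1)) => p q r; first lia.
have ne : i.+1 <> j.+1 by move=> e; rewrite e ltnn in p.
lia.
Qed.

Lemma ltn_pos A w i j : i <= ct A w n -> j <= ct A w n ->
  (pos A w i < pos A w j) = (i < j).
Proof. by move=> hi hj; rewrite !ltnNge leq_pos. Qed.

Lemma pos_neq A B w i j : 1 <= i <= ct A w n -> 1 <= j <= ct B w n ->
  A <> B -> pos A w i <> pos B w j.
Proof.
by move=> hi hj AB e; have := onth_pos _ _ _ hi; rewrite e onth_pos// => -[/esym].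
Qed.

(** Together with [pos_ct_gt], this brackets [x] between consecutive occurrences of [A], which later
    selects the nearest point of the opposite side. *)
Lemma pos_ct_le A w x : x <= n -> pos A w (ct A w x) <= x.
Proof.
move=> xn; case: (posnP (ct A w x)) => [->|c0]; first by rewrite pos0.
have hc : 1 <= ct A w x <= ct A w n by rewrite c0 leq_ct.
have hr := pos_range _ _ _ hc.
rewrite leqNgt; apply/negP => lt.
have := @leq_ct A w x (pos A w (ct A w x)).-1.
have := ct_pred _ _ _ hr (onth_pos _ _ _ hc); rewrite ct_pos//.
lia.
Qed.

Lemma pos_ct_gt A w x i : x <= n -> ct A w x < i -> i <= ct A w n ->
  x < pos A w i.
Proof.
move=> xn xi hi; rewrite ltnNge; apply/negP => le.
have hi' : 1 <= i <= ct A w n by lia.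
by have := leq_ct A w _ _ le xn; rewrite ct_pos//; lia.
Qed.

End Counting.

Lemma ct_complement {T : eqType} (A B : T) {n : nat} (w : n.-tuple T) x :
  A <> B -> (forall a : T, a = A \/ a = B) -> x <= n ->
  ct A w x + ct B w x = x.
Proof.
move=> AB cover xn.
have -> : ct B w x = count (predC (pred1 A)) (take x w).
  apply: eq_count => a /=; case: (cover a) => ->; rewrite eqxx.
    by apply/eqP; exact: AB.
  by apply/esym/eqP => e; apply: AB.
by rewrite count_predC size_takel// size_tuple.
Qed.

(** * Petrov conditions as a uniform integer estimate *)

Section NearHalf.
Context {T : eqType} {n : nat}.
Implicit Types (A : T) (w : n.-tuple T).

(** Says [|2 ct(i) - i| <= E] and [|pos(i) - 2 i| <= E], with the error added on either side to
    avoid truncated subtraction, in a form suited to linear arithmetic. *)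
Definition near_half (E : nat) A w : Prop :=
  (forall i, i <= n -> 2 * ct A w i <= i + E /\ i <= 2 * ct A w i + E) /\
  (forall i, i <= ct A w n -> pos A w i <= 2 * i + E /\ 2 * i <= pos A w i + E).

Local Open Scope ring_scope.

(** Take [j = 0] in the Petrov conditions. If [i < n ^ 0.6], the short-range condition bounds the
    error by [n ^ 0.4]; otherwise [i > n ^ 0.3] and the long-range one bounds it by a multiple of
    [i ^ 0.6]. Both are of order at most [n ^ 0.6]. *)
Lemma petrov_near_half (R : realType) (E : nat) A w :
  1 < (n%:R : R) `^ (3 / 10) -> 2 * (n%:R : R) `^ (6 / 10) <= E%:R ->
  petrov_label R A w -> near_half E A w.
Proof.
move=> t1 eE [c_near c_far p_near p_far].
have n1 : 1 <= (n%:R : R).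
  rewrite ler1n lt0n; apply/eqP => n0; move: t1; rewrite n0 powR0 ?ltr10//.
  by apply/eqP; lra.
have fe : (n%:R : R) `^ (4 / 10) <= n%:R `^ (6 / 10) by apply: ler_powR => //; lra.
have te : (n%:R : R) `^ (3 / 10) < n%:R `^ (6 / 10).
  rewrite (_ : 6 / 10 = 3 / 10 + 3 / 10 :> R); last by lra.
  rewrite powRD; last by apply/implyP => _; rewrite gt_eqF//; lra.
  by rewrite ltr_pMl//; lra.
have ie (i : nat) : (i <= n)%N -> (i%:R : R) `^ (6 / 10) <= n%:R `^ (6 / 10).
  by move=> lein; apply: ge0_ler_powR; rewrite ?nnegrE ?ler0n ?ler_nat//; lra.
have ct_le (i : nat) : (i <= n)%N ->
    `|(ct A w i)%:R - 1 / 2 * i%:R| <= (n%:R : R) `^ (6 / 10).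
  move=> lein; move: (c_near i 0%N lein isT) (c_far i 0%N lein isT).
  rewrite ct0 !subr0 [`|i%:R|]ger0_norm ?ler0n//.
  have := ie i lein; case: (ltP (i%:R : R) (n%:R `^ (6 / 10))) => [lt|ge].
    by move=> _ /(_ isT); lra.
  by move=> ? _ /(_ (lt_le_trans te ge)); lra.
have le_ctn : (ct A w n <= n)%N.
  by rewrite /ct (leq_trans (count_size _ _))// size_take size_tuple; case: ltnP.
have pos_le (i : nat) : (i <= ct A w n)%N ->
    `|(pos A w i)%:R - 2 * i%:R| <= 2 * (n%:R : R) `^ (6 / 10).
  move=> lei; move: (p_near i 0%N lei isT) (p_far i 0%N lei isT).
  rewrite pos0 !subr0 [`|i%:R|]ger0_norm ?ler0n//.
  have := ie i (leq_trans lei le_ctn).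
  case: (ltP (i%:R : R) (n%:R `^ (6 / 10))) => [lt|ge].
    by move=> _ /(_ isT); lra.
  by move=> ? _ /(_ (lt_le_trans te ge)); lra.
split=> i lei.
  have := ct_le i lei; rewrite ler_norml => /andP[? ?].
  split; rewrite -(ler_nat R) natrD natrM; lra.
have := pos_le i lei; rewrite ler_norml => /andP[? ?].
split; rewrite -(ler_nat R) natrD natrM; lra.
Qed.

End NearHalf.

(** * The error scale against the margins of [z0] *)

Section Scale.
Local Open Scope ring_scope.
Variable R : realType.

Lemma powR_large (c : R) : 0 <= c ->
  exists N : nat, forall n : nat, (N <= n)%N -> c <= (n%:R : R) `^ (3 / 10).
Proof.
move=> c0; exists (Num.truncn (c `^ (10 / 3))).+1 => n Nn.
have -> : c = (c `^ (10 / 3)) `^ (3 / 10).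
  by rewrite -powRrM (_ : 10 / 3 * (3 / 10) = 1 :> R) ?powRr1//; lra.
apply: ge0_ler_powR; rewrite ?nnegrE ?powR_ge0 ?ler0n//; first by lra.
by apply/ltW/(lt_le_trans (Num.Theory.truncnS_gt _)); rewrite ler_nat.
Qed.

(* The error scale is about [n ^ 0.6], hence negligible against the margins
   [n ^ 0.9] left by [z0]. *)
Lemma Omega_near_half : exists N : nat, forall n : nat, (N <= n)%N ->
  forall (X : n.-tuple ud) (Y : n.-tuple lr) (z0 : nat),
  Omega R n (X, Y, z0) -> exists E : nat,
  [/\ (1 <= E)%N, (20 * E <= z0)%N, (z0 + 20 * E <= n)%N,
      forall A, near_half E A X & forall A, near_half E A Y].
Proof.
(* With [t = n ^ 0.3], the error [E] is at most [2 t^2 + 1 <= 3 t^2], so [t >= 60] gives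
   [20 E <= t^3 = n ^ 0.9]. *)
have [|N NP] := powR_large 60; first by lra.
exists N => n /NP t60 X Y z0 [/andP[z1 zn] _ _ [pX pY] /andP[lo hi]].
set t := (n%:R : R) `^ (3 / 10) in t60.
have n0 : n%:R != 0 :> R.
  by apply/eqP => n0; move: t60; rewrite /t n0 powR0; [lra|apply/eqP; lra].
have e_tt : n%:R `^ (6 / 10) = t * t.
  by rewrite /t -powRD ?n0 ?implybT//; congr powR; lra.
have f_ttt : n%:R `^ (9 / 10) = t * t * t.
  by rewrite /t -!powRD ?n0 ?implybT//; congr powR; lra.
have e0 : 0 <= 2 * n%:R `^ (6 / 10) :> R by rewrite mulr_ge0 ?powR_ge0//; lra.
set E := (Num.truncn (2 * (n%:R : R) `^ (6 / 10))).+1.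
have [El Eh] : (E%:R <= 3 * (t * t) :> R) /\ 2 * n%:R `^ (6 / 10) <= E%:R :> R.
  have /andP[tl th] := Num.Theory.truncn_itv e0.
  split; last exact: ltW.
  rewrite /E -natr1; apply: (le_trans (lerD tl (lexx _))).
  rewrite e_tt; nra.
have E20 : 20 * E%:R <= t * t * t :> R by nra.
exists E; split=> //.
- by rewrite -(ler_nat R) natrM; move: lo; rewrite f_ttt; lra.
- by rewrite -(ler_nat R) natrD natrM; move: hi; rewrite f_ttt; lra.
- by move=> A; apply: petrov_near_half => //; rewrite -/t; lra.
- by move=> A; apply: petrov_near_half => //; rewrite -/t; lra.
Qed.

End Scale.

(** * Diagrams and records as sets of points *)

Section Diagrams.
Context {n : nat}.
Implicit Types (s : 'S_n) (S : set (nat * nat)).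

(** Choosing a point of [S] over each abscissa gives an injective map, hence a bijection by
    finiteness. Any point of [S] then shares its ordinate with a chosen point, and so equals it. *)
Lemma diagram_of_relation S :
  (forall p, S p -> 1 <= p.1 <= n /\ 1 <= p.2 <= n) ->
  (forall x, 1 <= x <= n -> exists y, S (x, y)) ->
  (forall p q, S p -> S q -> p.2 = q.2 -> p.1 = q.1) ->
  exists s : 'S_n, diagram s = S.
Proof.
move=> range total inj.
have /choice [f fP] : forall i : 'I_n, exists j : 'I_n, S (i.+1, j.+1).
  move=> i; have [y Sy] := total i.+1 (ltn_ord i).
  have [_ /= /andP[y1 yn]] := range _ Sy.
  have yn' : y.-1 < n by lia.
  by exists (Ordinal yn'); rewrite /= prednK.
have f_inj : injective f.
  by move=> i j e; apply/val_inj; have := inj _ _ (fP i) (fP j); rewrite /= e => /(_ erefl) [].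
exists (perm f_inj); apply/seteqP; split=> [_ [i _ <-]|[x y] Sp].
  by rewrite /pt permE; exact: fP.
have [/= xn yn] := range _ Sp.
have yn' : y.-1 < n by lia.
have [g fK gK] := injF_bij f_inj.
have := fP (g (Ordinal yn')); rewrite gK /= prednK; last by lia.
move=> Sq; exists (g (Ordinal yn')) => //.
by rewrite /pt permE gK /= prednK; [congr pair; exact: (inj _ _ Sq Sp erefl)|lia].
Qed.

(** This and its three analogues restate records through pairs of naturals, so that replacing
    [diagram s] by [Lambda] reduces them to comparisons between pieces. *)
Lemma LRminE s : LRmin s =
  [set p | diagram s p /\ forall q, diagram s q -> q.1 < p.1 -> p.2 < q.2].
Proof.
apply/seteqP; split=> [_ [i /= ri <-]|_ [[i _ <-] /= ri]].
  by split=> [|_ [j _ <-] /=]; [exists i|rewrite !ltnS => /ri].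
by exists i => //= j ji; have := ri (pt s j); rewrite /= !ltnS; apply=> //; exists j.
Qed.

Lemma LRmaxE s : LRmax s =
  [set p | diagram s p /\ forall q, diagram s q -> q.1 < p.1 -> q.2 < p.2].
Proof.
apply/seteqP; split=> [_ [i /= ri <-]|_ [[i _ <-] /= ri]].
  by split=> [|_ [j _ <-] /=]; [exists i|rewrite !ltnS => /ri].
by exists i => //= j ji; have := ri (pt s j); rewrite /= !ltnS; apply=> //; exists j.
Qed.

Lemma RLminE s : RLmin s =
  [set p | diagram s p /\ forall q, diagram s q -> p.1 < q.1 -> p.2 < q.2].
Proof.
apply/seteqP; split=> [_ [i /= ri <-]|_ [[i _ <-] /= ri]].
  by split=> [|_ [j _ <-] /=]; [exists i|rewrite !ltnS => /ri].
by exists i => //= j ji; have := ri (pt s j); rewrite /= !ltnS; apply=> //; exists j.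
Qed.

Lemma RLmaxE s : RLmax s =
  [set p | diagram s p /\ forall q, diagram s q -> p.1 < q.1 -> q.2 < p.2].
Proof.
apply/seteqP; split=> [_ [i /= ri <-]|_ [[i _ <-] /= ri]].
  by split=> [|_ [j _ <-] /=]; [exists i|rewrite !ltnS => /ri].
by exists i => //= j ji; have := ri (pt s j); rewrite /= !ltnS; apply=> //; exists j.
Qed.

End Diagrams.

(** * The four pieces of a fixed triple: sizes and index ranges *)

Section Rectangle.
Variables (n : nat) (X : n.-tuple ud) (Y : n.-tuple lr) (z0 E : nat).
Hypotheses (E1 : 1 <= E) (z0_lo : 20 * E <= z0) (z0_hi : z0 + 20 * E <= n).
Hypotheses (HX : forall A, near_half E A X) (HY : forall A, near_half E A Y).
Hypotheses (X1 : onth X 0 = Some Down) (Xn : onth X n.-1 = Some Down).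
Hypothesis Xz : onth X z0.-1 = Some Down.
Hypotheses (Y1 : onth Y 0 = Some Lft) (Yn : onth Y n.-1 = Some Lft).

Notation m := (ct Down X z0).
Notation cD := (ct Down X n).
Notation cU := (ct Up X n).
Notation cL := (ct Lft Y n).
Notation cR := (ct Rgt Y n).

Lemma ct_ud x : x <= n -> ct Down X x + ct Up X x = x.
Proof. by apply: ct_complement => //; case; [right|left]. Qed.

Lemma ct_lr x : x <= n -> ct Lft Y x + ct Rgt Y x = x.
Proof. by apply: ct_complement => //; case; [left|right]. Qed.

Let totals : cD + cU = n /\ cL + cR = n.
Proof. by rewrite ct_ud ?ct_lr. Qed.

(** The four pieces have [m], [cL - m], [cD - m] and [m + cU - cL] indices; the inequalities make
    each of them nonempty. *)
Let sizes : [/\ 1 <= m, m < cL, cL < m + cU, m < cD &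
  2 * m <= z0 + E /\ z0 <= 2 * m + E].
Proof.
have [a b] := (HX Down).1 z0 ltac:(lia).
have [c d] := (HX Down).1 n ltac:(lia).
have [e f] := (HY Lft).1 n ltac:(lia).
have [g h] := totals.
by split; lia.
Qed.

Let cD_near : 2 * cD <= n + E /\ n <= 2 * cD + E.
Proof. by apply: (HX Down).1. Qed.

Lemma pos_first (T : eqType) (A : T) (w : n.-tuple T) :
  onth w 0 = Some A -> 1 <= ct A w n /\ pos A w 1 = 1.
Proof.
move=> w1; have h1 : 1 <= 1 <= n by lia.
have c1 := ct_pred _ _ _ h1 w1; rewrite ct0 in c1.
by split; [rewrite -c1 leq_ct; lia|rewrite -{1}c1 pos_ct].
Qed.

(** The occurrence defining [z2] exists because [cL - m <= cU]; the cut between [Lambda2] and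
    [Lambda4] thereby becomes an explicit index. *)
Lemma ct_z2 : ct Up X (z2 X Y z0) = cL - m.
Proof. by have [? ? ? ? [? ?]] := sizes; rewrite ct_pos//; have := totals; lia. Qed.

Lemma Lambda1P p : Lambda1 X Y z0 p -> exists2 i : nat, (1 <= i <= m) &
  p = (pos Down X i, pos Lft Y (m + 1 - i)).
Proof. by move=> [i /= h <-]; exists i. Qed.

Lemma Lambda2P p : Lambda2 X Y z0 p -> exists2 i : nat, (1 <= i <= cL - m) &
  p = (pos Up X i, pos Lft Y (m + i)).
Proof. by move=> [i /=]; rewrite ct_z2 => h <-; exists i. Qed.

Lemma Lambda3P p : Lambda3 X Y z0 p -> exists2 i : nat, (m + 1 <= i <= cD) &
  p = (pos Down X i, pos Rgt Y (i - m)).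
Proof. by move=> [i /= h <-]; exists i. Qed.

Lemma Lambda4P p : Lambda4 X Y z0 p -> exists2 i : nat, (cL - m + 1 <= i <= cU) &
  p = (pos Up X i, pos Rgt Y (n - m + 1 - i)).
Proof. by move=> [i /=]; rewrite ct_z2 => h <-; exists i. Qed.

Lemma pos_z0 : pos Down X m = z0.
Proof. by apply: pos_ct => //; lia. Qed.

Lemma pos_last (T : eqType) (A : T) (w : n.-tuple T) :
  onth w n.-1 = Some A -> pos A w (ct A w n) = n.
Proof. by move=> wn; apply: pos_ct => //; lia. Qed.

(** * Corners, bounds and monotonicity of the pieces *)

Lemma Lambda1_corners : Lambda1 X Y z0 (1, z1 X Y z0) /\ Lambda1 X Y z0 (z0, 1).
Proof.
have [? ? ? ? [? ?]] := sizes.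
split; [exists 1|exists m] => /=; rewrite ?leqnn ?andbT//.
  by rewrite (pos_first _ _ _ X1).2 addnK.
by rewrite pos_z0 addnC addnK (pos_first _ _ _ Y1).2.
Qed.

Lemma Lambda2_corner : Lambda2 X Y z0 (z2 X Y z0, n).
Proof.
have [? ? ? ? [? ?]] := sizes.
exists (cL - m) => /=; first by rewrite ct_z2; lia.
by rewrite subnKC ?pos_last// ltnW.
Qed.

Lemma Lambda3_corner : Lambda3 X Y z0 (n, z3 X Y z0).
Proof.
have [? ? ? ? [? ?]] := sizes.
by exists cD => /=; [lia|rewrite pos_last].
Qed.

(** The box comes from monotonicity of [pos]. The two indices of a point sum to [m + 1], so its
    coordinates sum to [2 (m + 1)] up to [2 E], and [2 m] is [z0] up to [E]. The bounds on the other
    pieces arise likewise, from a constant sum or difference of indices. *)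
Lemma Lambda1_bounds p : Lambda1 X Y z0 p ->
  [/\ 1 <= p.1 <= z0, 1 <= p.2 <= z1 X Y z0 & p.1 + p.2 < n].
Proof.
have [? ? ? ? [? ?]] := sizes.
move=> /Lambda1P[i hi ->] /=; have hj : m + 1 - i <= m by lia.
have := pos_range Down X i ltac:(lia).
have := pos_range Lft Y (m + 1 - i) ltac:(lia).
have : pos Lft Y (m + 1 - i) <= z1 X Y z0 by rewrite leq_pos; lia.
have : pos Down X i <= z0 by rewrite -[Z in _ <= Z]pos_z0 leq_pos; lia.
have := (HX Down).2 i ltac:(lia); have := (HY Lft).2 (m + 1 - i) ltac:(lia).
by split; lia.
Qed.

Lemma Lambda2_bounds p : Lambda2 X Y z0 p ->
  [/\ 1 < p.1 <= z2 X Y z0, z1 X Y z0 < p.2 <= n & p.1 < p.2].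
Proof.
have [? ? ? ? [? ?]] := sizes; have [? ?] := totals.
have [? e] := pos_first _ _ _ X1.
move=> /Lambda2P[i hi ->] /=.
have := pos_range Up X i ltac:(lia).
have := pos_range Lft Y (m + i) ltac:(lia).
(* The first label of [X] is [Down], which makes the lower bound strict. *)
have : pos Up X i <> 1 by rewrite -[Z in _ <> Z]e; apply: pos_neq => //; lia.
have : z1 X Y z0 < pos Lft Y (m + i) by rewrite ltn_pos; lia.
have : pos Up X i <= z2 X Y z0 by rewrite leq_pos; lia.
have := (HX Up).2 i ltac:(lia); have := (HY Lft).2 (m + i) ltac:(lia).
by split; lia.
Qed.

Lemma Lambda3_bounds p : Lambda3 X Y z0 p ->
  [/\ z0 < p.1 <= n, 1 < p.2 <= z3 X Y z0 & p.2 < p.1].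
Proof.
have [? ? ? ? [? ?]] := sizes; have [? ?] := totals.
have [? e] := pos_first _ _ _ Y1.
move=> /Lambda3P[i hi ->] /=.
have := pos_range Down X i ltac:(lia).
have := pos_range Rgt Y (i - m) ltac:(lia).
have : pos Rgt Y (i - m) <> 1 by rewrite -[Z in _ <> Z]e; apply: pos_neq => //; lia.
have : z0 < pos Down X i by rewrite -[Z in Z < _]pos_z0 ltn_pos; lia.
have : pos Rgt Y (i - m) <= z3 X Y z0 by rewrite leq_pos; lia.
have := (HX Down).2 i ltac:(lia); have := (HY Rgt).2 (i - m) ltac:(lia).
by split; lia.
Qed.

Lemma Lambda4_bounds p : Lambda4 X Y z0 p ->
  [/\ z2 X Y z0 < p.1 < n, z3 X Y z0 < p.2 < n & n < p.1 + p.2].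
Proof.
have [? ? ? ? [? ?]] := sizes; have [? ?] := totals.
have eX := pos_last _ _ _ Xn; have eY := pos_last _ _ _ Yn.
move=> /Lambda4P[i hi ->] /=.
have := pos_range Up X i ltac:(lia).
have := pos_range Rgt Y (n - m + 1 - i) ltac:(lia).
have : pos Up X i <> n by rewrite -[Z in _ <> Z]eX; apply: pos_neq => //; lia.
have : pos Rgt Y (n - m + 1 - i) <> n.
  by rewrite -[Z in _ <> Z]eY; apply: pos_neq => //; lia.
have : z3 X Y z0 < pos Rgt Y (n - m + 1 - i) by rewrite ltn_pos; lia.
have : z2 X Y z0 < pos Up X i by rewrite ltn_pos; lia.
have := (HX Up).2 i ltac:(lia); have := (HY Rgt).2 (n - m + 1 - i) ltac:(lia).
by split; lia.
Qed.

Lemma Lambda1_anti p q : Lambda1 X Y z0 p -> Lambda1 X Y z0 q ->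
  (p.1 < q.1) = (q.2 < p.2).
Proof.
have [? ? ? ? [? ?]] := sizes.
by move=> /Lambda1P[i hi ->] /Lambda1P[j hj ->] /=; rewrite !ltn_pos; lia.
Qed.

Lemma Lambda2_mono p q : Lambda2 X Y z0 p -> Lambda2 X Y z0 q ->
  (p.1 < q.1) = (p.2 < q.2).
Proof.
have [? ? ? ? [? ?]] := sizes; have [? ?] := totals.
by move=> /Lambda2P[i hi ->] /Lambda2P[j hj ->] /=; rewrite !ltn_pos; lia.
Qed.

Lemma Lambda3_mono p q : Lambda3 X Y z0 p -> Lambda3 X Y z0 q ->
  (p.1 < q.1) = (p.2 < q.2).
Proof.
have [? ? ? ? [? ?]] := sizes; have [? ?] := totals.
by move=> /Lambda3P[i hi ->] /Lambda3P[j hj ->] /=; rewrite !ltn_pos; lia.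
Qed.

Lemma Lambda4_anti p q : Lambda4 X Y z0 p -> Lambda4 X Y z0 q ->
  (p.1 < q.1) = (q.2 < p.2).
Proof.
have [? ? ? ? [? ?]] := sizes; have [? ?] := totals.
by move=> /Lambda4P[i hi ->] /Lambda4P[j hj ->] /=; rewrite !ltn_pos; lia.
Qed.

(** Prevents [q] from being a left-to-right minimum where the corner [(z0, 1)] is not to its left.
    The witness sits at the last [Down] before [q.1]; the two sides are [2 (n - z0)] apart in
    height, up to a multiple of [E]. The next three lemmas do the same for the other kinds of
    record, with gap [2 z0] between [Lambda2] and [Lambda3]. *)
Lemma Lambda4_over_Lambda1 q : Lambda4 X Y z0 q -> q.1 <= z0 ->
  exists p, [/\ Lambda1 X Y z0 p, p.1 < q.1 & p.2 < q.2].
Proof.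
have [? ? ? ? [? ?]] := sizes; have [? ?] := totals.
move=> Lq qz; have [? ? ?] := Lambda4_bounds _ Lq.
case: (Lambda4P _ Lq) => j hj eq_q.
have [c1 e1] := pos_first _ _ _ X1.
set i := ct Down X q.1.
have i1 : 1 <= i.
  have := leq_ct Down X 1 q.1 ltac:(lia) ltac:(lia).
  by rewrite -[Z in ct Down X Z]e1 ct_pos ?c1.
have im : i <= m by apply: leq_ct; lia.
exists (pos Down X i, pos Lft Y (m + 1 - i)); split => /=.
- by exists i => //=; lia.
- have := pos_ct_le Down X q.1 ltac:(lia).
  have : pos Down X i <> q.1 by rewrite eq_q /=; apply: pos_neq => //; lia.
  by rewrite -/i; lia.
- have := (HX Down).1 q.1 ltac:(lia).
  have := (HY Lft).2 (m + 1 - i) ltac:(lia).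
  have := (HX Up).2 j ltac:(lia); have := (HY Rgt).2 (n - m + 1 - j) ltac:(lia).
  have : q.1 = pos Up X j /\ q.2 = pos Rgt Y (n - m + 1 - j) by rewrite eq_q.
  by rewrite -/i; lia.
Qed.

Lemma Lambda3_under_Lambda2 q : Lambda3 X Y z0 q -> q.1 <= z2 X Y z0 ->
  exists p, [/\ Lambda2 X Y z0 p, p.1 < q.1 & q.2 < p.2].
Proof.
have [? ? ? ? [? ?]] := sizes; have [? ?] := totals.
move=> Lq qz; have [? ? ?] := Lambda3_bounds _ Lq.
case: (Lambda3P _ Lq) => k hk eq_q.
set i := ct Up X q.1.
have ci := (HX Up).1 q.1 ltac:(lia); rewrite -/i in ci.
(* The bound [q.1 <= z2] keeps the last [Up] before [q.1] in [Lambda2] rather than [Lambda4]. *)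
have im : i <= cL - m.
  rewrite -ct_z2; apply: leq_ct => //.
  by have /andP[] := pos_range Up X (cL - m) ltac:(lia).
exists (pos Up X i, pos Lft Y (m + i)); split => /=.
- by exists i => //=; rewrite ct_z2; lia.
- have := pos_ct_le Up X q.1 ltac:(lia).
  have : pos Up X i <> q.1 by rewrite eq_q /=; apply: pos_neq => //; lia.
  by rewrite -/i; lia.
- by have := (HY Lft).2 (m + i) ltac:(lia); lia.
Qed.

Lemma Lambda2_over_Lambda3 q : Lambda2 X Y z0 q -> z0 <= q.1 ->
  exists p, [/\ Lambda3 X Y z0 p, q.1 < p.1 & p.2 < q.2].
Proof.
have [? ? ? ? [? ?]] := sizes; have [? ?] := totals.
move=> Lq qz; have [? ? ?] := Lambda2_bounds _ Lq.
case: (Lambda2P _ Lq) => i hi eq_q.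
have /andP[q0 qn] : 1 <= q.1 <= n by rewrite eq_q; apply: pos_range; lia.
have q_n : q.1 <> n.
  by rewrite eq_q /= -[Z in _ <> Z](pos_last _ _ _ Xn); apply: pos_neq => //; lia.
set k := (ct Down X q.1).+1.
have ck := (HX Down).1 q.1 ltac:(lia).
have km : m <= ct Down X q.1 by apply: leq_ct; lia.
(* Since [q.1 < n] and the last label of [X] is [Down], a [Down] remains after [q.1]. *)
have kd : k <= cD.
  have := leq_ct Down X q.1 n.-1 ltac:(lia) ltac:(lia).
  by rewrite (ct_pred Down X n) //; lia.
exists (pos Down X k, pos Rgt Y (k - m)); split => /=.
- by exists k => //=; lia.
- by apply: pos_ct_gt.
- by have := (HY Rgt).2 (k - m) ltac:(lia); lia.
Qed.

Lemma Lambda1_under_Lambda4 q : Lambda1 X Y z0 q -> z2 X Y z0 <= q.1 ->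
  exists p, [/\ Lambda4 X Y z0 p, q.1 < p.1 & q.2 < p.2].
Proof.
have [? ? ? ? [? ?]] := sizes; have [? ?] := totals; have [? ?] := cD_near.
move=> Lq qz; have [? ? ?] := Lambda1_bounds _ Lq.
set j := (ct Up X q.1).+1.
have cj := (HX Up).1 q.1 ltac:(lia).
have jm : cL - m <= ct Up X q.1 by rewrite -ct_z2 leq_ct; lia.
(* Here a further [Up] exists by counting: [q.1 <= z0] leaves at least [20 E] indices to the
   right. *)
have ju : j <= cU by lia.
exists (pos Up X j, pos Rgt Y (n - m + 1 - j)); split => /=.
- by exists j => //=; rewrite ct_z2; lia.
- by apply: pos_ct_gt => //; lia.
- by have := (HY Rgt).2 (n - m + 1 - j) ltac:(lia); lia.
Qed.

(** * The union of the pieces is the diagram of a permutation *)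

Lemma Lambda_range p : Lambda X Y z0 p -> 1 <= p.1 <= n /\ 1 <= p.2 <= n.
Proof.
have [? ? ? ? [? ?]] := sizes; have [? ?] := totals.
have /andP[_ z1n] : 1 <= z1 X Y z0 <= n by apply: pos_range; lia.
have /andP[_ z2n] : 1 <= z2 X Y z0 <= n by apply: pos_range; lia.
have /andP[_ z3n] : 1 <= z3 X Y z0 <= n by apply: pos_range; lia.
by move=> [[[/Lambda1_bounds|/Lambda2_bounds]|/Lambda3_bounds]|/Lambda4_bounds] [];
  split; lia.
Qed.

Lemma Lambda_total x : 1 <= x <= n -> exists y, Lambda X Y z0 (x, y).
Proof.
move=> xn; have [? ? ? ? [? ?]] := sizes; have [? ?] := totals.
have : onth X x.-1 by rewrite onthTE size_tuple; lia.
case wx: (onth X x.-1) => [[]|] // _.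
- have e := pos_ct Up X x xn wx; set i := ct Up X x in e.
  have i1 : 1 <= i by rewrite /i ct_pred.
  have iu : i <= cU by apply: leq_ct; lia.
  case: (leqP i (cL - m)) => im.
    exists (pos Lft Y (m + i)); left; left; right.
    by exists i => /=; [rewrite ct_z2; lia|rewrite e].
  exists (pos Rgt Y (n - m + 1 - i)); right.
  by exists i => /=; [rewrite ct_z2; lia|rewrite e].
- have e := pos_ct Down X x xn wx; set i := ct Down X x in e.
  have i1 : 1 <= i by rewrite /i ct_pred.
  have iu : i <= cD by apply: leq_ct; lia.
  case: (leqP i m) => im.
    exists (pos Lft Y (m + 1 - i)); left; left; left.
    by exists i => /=; [lia|rewrite e].
  exists (pos Rgt Y (i - m)); left; right.
  by exists i => /=; [lia|rewrite e].
Qed.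

Lemma Lambda1_labels p : Lambda1 X Y z0 p ->
  onth X p.1.-1 = Some Down /\ onth Y p.2.-1 = Some Lft.
Proof.
have [? ? ? ? [? ?]] := sizes; have [? ?] := totals.
by move=> /Lambda1P[i hi ->] /=; split; apply: onth_pos; lia.
Qed.

Lemma Lambda2_labels p : Lambda2 X Y z0 p ->
  onth X p.1.-1 = Some Up /\ onth Y p.2.-1 = Some Lft.
Proof.
have [? ? ? ? [? ?]] := sizes; have [? ?] := totals.
by move=> /Lambda2P[i hi ->] /=; split; apply: onth_pos; lia.
Qed.

Lemma Lambda3_labels p : Lambda3 X Y z0 p ->
  onth X p.1.-1 = Some Down /\ onth Y p.2.-1 = Some Rgt.
Proof.
have [? ? ? ? [? ?]] := sizes; have [? ?] := totals.
by move=> /Lambda3P[i hi ->] /=; split; apply: onth_pos; lia.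
Qed.

Lemma Lambda4_labels p : Lambda4 X Y z0 p ->
  onth X p.1.-1 = Some Up /\ onth Y p.2.-1 = Some Rgt.
Proof.
have [? ? ? ? [? ?]] := sizes; have [? ?] := totals.
by move=> /Lambda4P[i hi ->] /=; split; apply: onth_pos; lia.
Qed.

(** The inverse permutation in closed form: the label of [y] and its rank among equal labels
    determine the piece and the index within it. *)
Definition abscissa (y : nat) : nat :=
  if onth Y y.-1 == Some Lft then
    let k := ct Lft Y y in
    if k <= m then pos Down X (m + 1 - k) else pos Up X (k - m)
  else
    let k := ct Rgt Y y in
    if k <= cD - m then pos Down X (m + k) else pos Up X (n - m + 1 - k).

Lemma abscissaE p : Lambda X Y z0 p -> abscissa p.2 = p.1.
Proof.
have [? ? ? ? [? ?]] := sizes; have [? ?] := totals.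
rewrite /abscissa => -[[[]|]|] Lp.
- rewrite (Lambda1_labels _ Lp).2 eqxx; case: (Lambda1P _ Lp) => i hi -> /=.
  by rewrite ct_pos ?ifT; [congr pos| |]; lia.
- rewrite (Lambda2_labels _ Lp).2 eqxx; case: (Lambda2P _ Lp) => i hi -> /=.
  by rewrite ct_pos ?ifF; [congr pos| |]; lia.
- rewrite (Lambda3_labels _ Lp).2 /=; case: (Lambda3P _ Lp) => i hi -> /=.
  by rewrite ct_pos ?ifT; [congr pos| |]; lia.
- rewrite (Lambda4_labels _ Lp).2 /=; case: (Lambda4P _ Lp) => i hi -> /=.
  by rewrite ct_pos ?ifF; [congr pos| |]; lia.
Qed.

Lemma Lambda_inj p q : Lambda X Y z0 p -> Lambda X Y z0 q ->
  p.2 = q.2 -> p.1 = q.1.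
Proof. by move=> /abscissaE <- /abscissaE <- ->. Qed.

Lemma diagram_rho : diagram (rho (X, Y, z0)) = Lambda X Y z0.
Proof.
apply: (@xgetPex _ _ [set s : 'S_n | diagram s = Lambda X Y z0]).
apply: diagram_of_relation; [exact: Lambda_range|exact: Lambda_total|].
exact: Lambda_inj.
Qed.

(** * Records, squareness and recovery of the triple *)

Section Records.
Variable s : 'S_n.
Hypothesis diagram_s : diagram s = Lambda X Y z0.

(** The corner [(1, z1)] excludes [Lambda2], and [(z0, 1)] excludes [Lambda3] and the part of
    [Lambda4] to its right; the rest of [Lambda4] lies over nearby points of [Lambda1]. *)
Lemma LRmin_Lambda : LRmin s = Lambda1 X Y z0.
Proof.
have [C1 C1'] := Lambda1_corners.
rewrite LRminE diagram_s; apply/seteqP; split=> [p [Lp rp]|p Lp].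
  have rec q (Lq : Lambda1 X Y z0 q) : q.1 < p.1 -> p.2 < q.2.
    by apply: rp; do 3 left.
  case: Lp => [[[//|Lp]|Lp]|Lp].
  - by have := rec _ C1; have [] := Lambda2_bounds _ Lp; move=> /=; lia.
  - by have := rec _ C1'; have [] := Lambda3_bounds _ Lp; move=> /=; lia.
  - case: (leqP p.1 z0) => pz.
      by have [q [Lq qp]] := Lambda4_over_Lambda1 _ Lp pz; have := rec _ Lq qp; lia.
    by have := rec _ C1'; have [] := Lambda4_bounds _ Lp; move=> /=; lia.
have [? ? ?] := Lambda1_bounds _ Lp.
split=> [|q [[[Lq|Lq]|Lq]|Lq]]; first by do 3 left.
- by rewrite (Lambda1_anti _ _ Lq Lp).
- by have [] := Lambda2_bounds _ Lq; lia.
- by have [] := Lambda3_bounds _ Lq; lia.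
- by have [] := Lambda4_bounds _ Lq; lia.
Qed.

Lemma LRmax_Lambda : LRmax s = Lambda2 X Y z0 `|` [set (1, z1 X Y z0)].
Proof.
have [C1 _] := Lambda1_corners; have C2 := Lambda2_corner.
rewrite LRmaxE diagram_s; apply/seteqP; split=> [p [Lp rp]|p [Lp|->]].
- have rec1 q (Lq : Lambda1 X Y z0 q) : q.1 < p.1 -> q.2 < p.2.
    by apply: rp; do 3 left.
  have rec2 q (Lq : Lambda2 X Y z0 q) : q.1 < p.1 -> q.2 < p.2.
    by apply: rp; do 2 left; right.
  case: Lp => [[[Lp|Lp]|Lp]|Lp].
  (* [Lambda1] decreases from [(1, z1)], so only this first point survives. *)
  - right; have := rec1 _ C1; have := Lambda1_anti _ _ C1 Lp.
    have [/=] := Lambda1_bounds _ Lp.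
    by case: p {Lp rp rec1 rec2} => x y /= ? ? ? ? ?; congr pair; lia.
  - by left.
  - case: (leqP p.1 (z2 X Y z0)) => pz.
      by have [q [Lq qp]] := Lambda3_under_Lambda2 _ Lp pz; have := rec2 _ Lq qp; lia.
    by have := rec2 _ C2; have [] := Lambda3_bounds _ Lp; have := Lambda_range p;
      rewrite /Lambda => /(_ (or_introl (or_intror Lp))) /=; lia.
  - by have := rec2 _ C2; have [] := Lambda4_bounds _ Lp; move=> /=; lia.
- have [? ? ?] := Lambda2_bounds _ Lp.
  split=> [|q [[[Lq|Lq]|Lq]|Lq]]; first by do 2 left; right.
  - by have [] := Lambda1_bounds _ Lq; lia.
  - by rewrite (Lambda2_mono _ _ Lq Lp).
  - by have [] := Lambda3_bounds _ Lq; lia.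
  - by have [] := Lambda4_bounds _ Lq; lia.
- split=> [|q /Lambda_range /=]; first by do 3 left.
  by lia.
Qed.

Lemma RLmin_Lambda : RLmin s = Lambda3 X Y z0 `|` [set (z0, 1)].
Proof.
have [_ C1] := Lambda1_corners; have C3 := Lambda3_corner.
rewrite RLminE diagram_s; apply/seteqP; split=> [p [Lp rp]|p [Lp|->]].
- have rec1 q (Lq : Lambda1 X Y z0 q) : p.1 < q.1 -> p.2 < q.2.
    by apply: rp; do 3 left.
  have rec3 q (Lq : Lambda3 X Y z0 q) : p.1 < q.1 -> p.2 < q.2.
    by apply: rp; left; right.
  case: Lp => [[[Lp|Lp]|Lp]|Lp].
  (* [Lambda1] decreases to [(z0, 1)], so only this last point survives. *)
  - right; have := rec1 _ C1; have := Lambda1_anti _ _ Lp C1.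
    have := Lambda1_anti _ _ C1 Lp; have [/=] := Lambda1_bounds _ Lp.
    by case: p {Lp rp rec1 rec3} => x y /= ? ? ? ? ? ?; congr pair; lia.
  - case: (leqP z0 p.1) => pz.
      by have [q [Lq qp]] := Lambda2_over_Lambda3 _ Lp pz; have := rec3 _ Lq qp; lia.
    by have := rec1 _ C1; have [] := Lambda2_bounds _ Lp; move=> /=; lia.
  - by left.
  - by have := rec3 _ C3; have [] := Lambda4_bounds _ Lp; move=> /=; lia.
- have [? ? ?] := Lambda3_bounds _ Lp.
  split=> [|q [[[Lq|Lq]|Lq]|Lq]]; first by left; right.
  - by have [] := Lambda1_bounds _ Lq; lia.
  - by have [] := Lambda2_bounds _ Lq; lia.
  - by rewrite (Lambda3_mono _ _ Lp Lq).
  - by have [] := Lambda4_bounds _ Lq; lia.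
- split=> [|q [[[Lq|Lq]|Lq]|Lq]] /=; first by do 3 left.
  - by have [] := Lambda1_bounds _ Lq; lia.
  - by have [] := Lambda2_bounds _ Lq; lia.
  - by have [] := Lambda3_bounds _ Lq; lia.
  - by have [] := Lambda4_bounds _ Lq; lia.
Qed.

Lemma RLmax_Lambda :
  RLmax s = Lambda4 X Y z0 `|` [set (z2 X Y z0, n); (n, z3 X Y z0)].
Proof.
have C2 := Lambda2_corner; have C3 := Lambda3_corner.
rewrite RLmaxE diagram_s; apply/seteqP; split=> [p [Lp rp]|p [Lp|[->|->]]].
- have rec2 q (Lq : Lambda2 X Y z0 q) : p.1 < q.1 -> q.2 < p.2.
    by apply: rp; do 2 left; right.
  have rec3 q (Lq : Lambda3 X Y z0 q) : p.1 < q.1 -> q.2 < p.2.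
    by apply: rp; left; right.
  have rec4 q (Lq : Lambda4 X Y z0 q) : p.1 < q.1 -> q.2 < p.2.
    by apply: rp; right.
  have /= pn := Lambda_range _ Lp; case: Lp => [[[Lp|Lp]|Lp]|Lp].
  - case: (leqP (z2 X Y z0) p.1) => pz.
      by have [q [Lq qp]] := Lambda1_under_Lambda4 _ Lp pz; have := rec4 _ Lq qp; lia.
    by have := rec2 _ C2; move=> /=; lia.
  (* [Lambda2] and [Lambda3] increase up to [(z2, n)] and [(n, z3)], so only these end points
     survive. *)
  - right; left; have := rec2 _ C2; have := Lambda2_mono _ _ Lp C2.
    have := Lambda2_mono _ _ C2 Lp; have [/=] := Lambda2_bounds _ Lp.
    by case: p pn {Lp rp rec2 rec3 rec4} => x y /= ? ? ? ? ? ? ?; congr pair; lia.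
  - right; right; have := rec3 _ C3; have := Lambda3_mono _ _ Lp C3.
    have := Lambda3_mono _ _ C3 Lp; have [/=] := Lambda3_bounds _ Lp.
    by case: p pn {Lp rp rec2 rec3 rec4} => x y /= ? ? ? ? ? ? ?; congr pair; lia.
  - by left.
- have [? ? ?] := Lambda4_bounds _ Lp.
  split=> [|q [[[Lq|Lq]|Lq]|Lq]]; first by right.
  - by have [] := Lambda1_bounds _ Lq; lia.
  - by have [] := Lambda2_bounds _ Lq; lia.
  - by have [] := Lambda3_bounds _ Lq; lia.
  - by rewrite (Lambda4_anti _ _ Lp Lq).
- have [/= ? ? ?] := Lambda2_bounds _ C2.
  split=> [|q [[[Lq|Lq]|Lq]|Lq]] /=; first by do 2 left; right.
  - by have [] := Lambda1_bounds _ Lq; lia.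
  - by have [] := Lambda2_bounds _ Lq; lia.
  - by have [] := Lambda3_bounds _ Lq; have [] := Lambda3_bounds _ C3 => /=; lia.
  - by have [] := Lambda4_bounds _ Lq; lia.
- split=> [|q /Lambda_range /=]; first by left; right.
  by lia.
Qed.

Lemma Sq_Lambda : Sq n s.
Proof.
rewrite /Sq /= LRmin_Lambda LRmax_Lambda RLmin_Lambda RLmax_Lambda diagram_s.
move=> p [[[Lp|Lp]|Lp]|Lp].
- by left; left; right.
- by do 4 left.
- by right; left.
- by left; right; left.
Qed.

(** Minima have abscissas labelled [Down], and left-to-right records have ordinates labelled [Lft].
    The extra corners [(z0, 1)] and [(1, z1)] lie in [Lambda1], so they agree with the tie-breaking
    convention of [phi]. *)
Lemma phi_Lambda : phi s = (X, Y, z0).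
Proof.
have pt_Lambda i : Lambda X Y z0 (pt s i) by rewrite -diagram_s; exists i.
have [C1 C1'] := Lambda1_corners.
rewrite /phi; congr (_, _, _).
- apply: eq_from_tnth => i; rewrite tnth_mktuple; apply/esym/tnth_onth.
  rewrite RLmin_Lambda LRmin_Lambda.
  case: eqP => [->//|_] /=; case: eqP => [e|_] /=; first by rewrite -Xn; congr onth; lia.
  have := Lambda1_labels (pt s i); have := Lambda2_labels (pt s i).
  have := Lambda3_labels (pt s i); have := Lambda4_labels (pt s i).
  case: ifPn => [/set_mem L|/negP nL] l4 l3 l2 l1.
    by case: L => [/l1[]|[/l3[]|e]]//; have []// := l1 _; rewrite e.
  case: (pt_Lambda i) => [[[Lp|/l2[]]|Lp]|/l4[]]//; case: nL;
    apply/mem_set; [by left|by right; left].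
- apply: eq_from_tnth => v; rewrite tnth_mktuple; apply/esym/tnth_onth.
  rewrite LRmax_Lambda LRmin_Lambda.
  case: eqP => [->//|_] /=; case: eqP => [e|_] /=; first by rewrite -Yn; congr onth; lia.
  set i := (s^-1%g v).
  have := Lambda1_labels (pt s i); have := Lambda2_labels (pt s i).
  have := Lambda3_labels (pt s i); have := Lambda4_labels (pt s i).
  have -> : (pt s i).2.-1 = v by rewrite /= permKV.
  case: ifPn => [/set_mem L|/negP nL] l4 l3 l2 l1.
    by case: L => [/l1[]|[/l2[]|e]]//; have []// := l1 _; rewrite e.
  case: (pt_Lambda i) => [[[Lp|Lp]|/l3[]]|/l4[]]//; case: nL;
    apply/mem_set; [by left|by right; left].
(* The point [(z0, 1)] is in the diagram, so the default is excluded, and injectivity in the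
   ordinate identifies the index found. *)
- case: pickP => [i /eqP si|no].
    by have := Lambda_inj _ _ (pt_Lambda i) (or_introl (or_introl (or_introl C1')));
      rewrite /= si; apply.
  have : diagram s (z0, 1) by rewrite diagram_s; do 3 left.
  by case=> i _ [_ si]; have := no i; rewrite si.
Qed.

End Records.

End Rectangle.

Theorem lemma3p7 (R : realType) :
  exists N : nat, forall n : nat, N <= n ->
    (forall (X : n.-tuple ud) (Y : n.-tuple lr) (z0 : nat),
       Omega R n (X, Y, z0) ->
       let s := rho (X, Y, z0) in
       diagram s = Lambda X Y z0 /\
       Sq n s /\
       LRmin s = Lambda1 X Y z0 /\
       LRmax s = Lambda2 X Y z0 `|` [set (1, z1 X Y z0)] /\
       RLmin s = Lambda3 X Y z0 `|` [set (z0, 1)] /\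
       RLmax s = Lambda4 X Y z0 `|` [set (z2 X Y z0, n); (n, z3 X Y z0)]) /\
    set_inj (Omega R n) (@rho n) /\
    (forall w : triple n, Omega R n w -> phi (rho w) = w).
Proof.
have [N NP] := Omega_near_half R; exists N => n /NP {}NP.
have phi_rho w : Omega R n w -> phi (rho w) = w.
  case: w => [[X Y] z0] /[dup] /NP[E [E1 lo hi HX HY]] [_ [X1 Xn Xz] [Y1 Yn] _ _].
  apply: (phi_Lambda _ _ _ _ E) => //.
  exact: (diagram_rho _ _ _ _ E).
split; [|split=> //].
- move=> X Y z0 /[dup] /NP[E [E1 lo hi HX HY]] [_ [X1 Xn Xz] [Y1 Yn] _ _] s.
  have ds : diagram s = Lambda X Y z0 by exact: (diagram_rho _ _ _ _ E).
  split=> //; split; first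
    exact (Sq_Lambda _ _ _ _ _ E1 lo hi HX HY X1 Xn Xz Y1 Yn _ ds).
  split; first exact: (LRmin_Lambda _ _ _ _ E).
  split; first exact: (LRmax_Lambda _ _ _ _ E).
  by split; [exact: (RLmin_Lambda _ _ _ _ E)|exact: (RLmax_Lambda _ _ _ _ E)].
- move=> w w' /set_mem Ow /set_mem Ow' e.
  by rewrite -(phi_rho w)// e phi_rho.
Qed.
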